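(* Let $f$ be an entire transcendental function, let $$M(\rho) = \frac1\pi \int_0^{2\pi} \left| f\left(\tfrac12\left(\rho e^{i\theta} + (\rho e^{i\theta})^{-1}\right)\right)\right| d\theta, \qquad \rho\ge 1,$$ and assume that $$M(\rho) \sim e^{\mu\rho^\nu}\rho^{\varsigma}, \qquad \rho\to\infty,$$ where $\mu$ is positive and finite, $\nu$ is positive and $\varsigma$ is real. Then the optimal radius $\rho^*(n)$ satisfies asymptotically, as $n\to\infty$, $$\rho^*(n) \sim \left(\frac{n-\varsigma}{\mu\nu}\right)^{1/\nu}.$$
   Context: The notation $A\sim B$ means that the ratio $A/B$ tends to $1$. The Chebyshev coefficients of the first kind of $f$ are $a_n = \frac{2}{\pi}\int_{-1}^1 \frac{f(x)T_n(x)}{\sqrt{1-x^2}}\,dx$, where $T_n(\cos\theta)=\cos(n\theta)$. For $a_n\ne0$ the condition number is $$\kappa^{\mathrm{Ch1}}(n,\rho) = \frac{\int_0^{2\pi}\left|f\left(\frac12(\rho e^{i\theta}+(\rho e^{i\theta})^{-1})\right)\right|d\theta}{\left|\int_0^{2\pi} f\left(\frac12(\rho e^{i\theta}+(\rho e^{i\theta})^{-1})\right)e^{-in\theta}d\theta\right|} = \frac{M(\rho)}{|a_n|\rho^n}, \qquad \rho \ge 1.$$ The optimal radius $\rho^*(n)$ is a value of $\rho\ge 1$ that minimizes $\kappa^{\mathrm{Ch1}}(n,\rho)$ over $\rho \ge 1$; only indices $n$ with $a_n\neq 0$ are considered (equivalently, $\rho^*(n)$ minimizes $M(\rho)\rho^{-n}$).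 *)

(* Defs.v *)
(* Classical real numbers of Stdlib, with Coquelicot for complex numbers,
   limits and integrals. *)
From Stdlib Require Import Reals.
From Coquelicot Require Import Coquelicot.
Local Open Scope R_scope.

Definition entire (f : C -> C) : Prop :=
  forall z : C, @ex_derive C_AbsRing C_NormedModule f z.

Definition is_polynomial (f : C -> C) : Prop :=
  exists (d : nat) (c : nat -> C),
    forall z : C, f z = sum_n (fun k => (c k * Cpow z k)%C) d.

Definition entire_transcendental (f : C -> C) : Prop :=
  entire f /\ ~ is_polynomial f.

Definition Cis (theta : R) : C := (cos theta, sin theta).

Definition joukowski (w : C) : C := ((w + / w) / 2)%C.

Definition ellipse (rho theta : R) : C := joukowski (RtoC rho * Cis theta)%C.

Definition ChebT (n : nat) (x : R) : R := cos (INR n * acos x).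

(* Improper at both endpoints, where the weight 1 / sqrt (1 - x^2) blows up. *)
Definition cheb_coef (f : C -> C) (n : nat) : C :=
  (RtoC (2 / PI) *
   @RInt_gen C_R_CompleteNormedModule
     (fun x : R => f (RtoC x) * RtoC (ChebT n x) / RtoC (sqrt (1 - x ^ 2)))
     (at_right (-1)) (at_left 1))%C.

Definition abs_mean (f : C -> C) (rho : R) : R :=
  1 / PI * RInt (fun theta => Cmod (f (ellipse rho theta))) 0 (2 * PI).

Definition kappa_Ch1 (f : C -> C) (n : nat) (rho : R) : R :=
  RInt (fun theta => Cmod (f (ellipse rho theta))) 0 (2 * PI) /
  Cmod (@RInt C_R_CompleteNormedModule
          (fun theta => f (ellipse rho theta) * Cis (- (INR n * theta)))%C
          0 (2 * PI)).

Definition is_optimal_radius (f : C -> C) (n : nat) (rho : R) : Prop :=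
  1 <= rho /\ forall r : R, 1 <= r -> kappa_Ch1 f n rho <= kappa_Ch1 f n r.

(* Main.v *)
(* In the coordinate z = ln rho + i theta the integrand
   f((w + 1/w)/2) w^(-n), w = e^z, is entire and 2 pi i-periodic, so Goursat's
   theorem on the rectangle [0, ln rho] x [0, 2 pi] shows that its integral over
   theta does not depend on rho. Hence the denominator of kappa is a constant
   times rho^n, the constant being a nonzero multiple of |a_n| (substitute
   x = cos theta at rho = 1), and rho*(n) minimizes M(rho) rho^(-n). Applied to a
   fixed index m with a_m <> 0, the same fact bounds M below by a positive
   constant, which forces rho*(n) -> oo; there M may be replaced, up to a factor 2,
   by e^(mu rho^nu) rho^sigma. With r_n = ((n - sigma)/(mu nu))^(1/nu) and
   v = nu ln(rho*(n)/r_n), minimality gives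
   (n - sigma)/nu * (e^v - 1 - v) <= 2 ln 2, so v -> 0. *)
Require Import Defs.
From Stdlib Require Import Reals Lra Lia Classical.
From Coquelicot Require Import Coquelicot.
Local Open Scope R_scope.

Local Notation CRInt := (@RInt C_R_CompleteNormedModule).
Local Notation Cex_RInt := (@ex_RInt C_R_NormedModule).
Local Notation Cderivable := (@ex_derive C_AbsRing C_NormedModule).
Local Notation Cis_derive := (@is_derive C_AbsRing C_NormedModule).

(* [ring] on [C] does not recognise the operations of the canonical structures. *)
Local Ltac toC :=
  change plus with Cplus; change opp with Copp; change minus with Cminus;
  lazymatch goal with |- @eq _ ?x ?y => change (@eq C x y) end.

(** * Complex differentiability and continuity *)

Lemma Cis_derive_eps (h : C -> C) (z l : C) :
  Cis_derive h z l <->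
  (forall eps : posreal, exists delta : posreal, forall w : C,
     Cmod (w - z) < delta ->
     Cmod (h w - h z - (w - z) * l)%C <= eps * Cmod (w - z)).
Proof.
split.
- intros [_ H] eps.
  destruct (H z (fun P HP => HP) eps) as [d Hd].
  exists d; intros w Hw.
  exact (Hd w Hw).
- intros H; split; [apply is_linear_scal_l|].
  intros x Hx eps.
  (* The derivative is required at every limit of the neighbourhood filter of [z]; by uniqueness of
     limits that is [z] alone. *)
  replace x with z in * by (apply (is_filter_lim_locally_unique (V := AbsRing_NormedModule C_AbsRing) z x Hx)).
  destruct (H eps) as [d Hd].
  exists d; intros w Hw.
  exact (Hd w Hw).
Qed.

Lemma Cmod_le_Rabs (x y : R) : Cmod (x, y) <= Rabs x + Rabs y.
Proof.
replace (x, y) with (RtoC x + Ci * RtoC y)%C.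
- rewrite <- (Cmod_R x), <- (Cmod_R y), <- (Rmult_1_l (Cmod y)), <- Cmod_Ci, <- Cmod_mult.
  apply Cmod_triangle.
- unfold Ci, RtoC, Cplus, Cmult; simpl; f_equal; ring.
Qed.

(** Balls of [C_UniformSpace] are tested coordinatewise, and each coordinate is bounded by the
    modulus. *)
Lemma continuous_C_eps (g : R -> C) (t : R) :
  (forall eps : posreal, exists delta : posreal, forall u : R,
     Rabs (u - t) < delta -> Cmod (g u - g t) < eps) ->
  @continuous R_UniformSpace C_UniformSpace g t.
Proof.
intros H; apply filterlim_locally; intros eps.
destruct (H eps) as [d Hd].
exists d; intros u Hu.
specialize (Hd u Hu).
split.
- apply Rle_lt_trans with (2 := Hd).
  apply Rle_trans with (2 := Rmax_Cmod _).
  exact (Rmax_l (Rabs (fst (g u - g t)%C)) _).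
- apply Rle_lt_trans with (2 := Hd).
  apply Rle_trans with (2 := Rmax_Cmod _).
  exact (Rmax_r _ (Rabs (snd (g u - g t)%C))).
Qed.

Lemma Cderivable_continuous (h : C -> C) (z : C) :
  Cderivable h z ->
  forall eps : posreal, exists delta : posreal, forall w : C,
    Cmod (w - z) < delta -> Cmod (h w - h z) < eps.
Proof.
intros [l Hl] eps.
destruct (proj1 (Cis_derive_eps h z l) Hl (mkposreal 1 Rlt_0_1)) as [d Hd].
simpl in Hd.
assert (Hk : 0 < 1 + Cmod l) by (pose proof (Cmod_ge_0 l); lra).
assert (Hm : 0 < Rmin d (eps / (1 + Cmod l))).
{ apply Rmin_case; [apply d|apply Rdiv_lt_0_compat; [apply eps|exact Hk]]. }
exists (mkposreal _ Hm); simpl; intros w Hw.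
assert (H1 := Rlt_le_trans _ _ _ Hw (Rmin_l _ _)).
assert (H2 := Rlt_le_trans _ _ _ Hw (Rmin_r _ _)).
replace (h w - h z)%C with ((h w - h z - (w - z) * l) + (w - z) * l)%C by ring.
apply Rle_lt_trans with (1 := Cmod_triangle _ _).
rewrite Cmod_mult.
specialize (Hd w H1).
apply Rle_lt_trans with (Cmod (w - z) * (1 + Cmod l)); [lra|].
apply Rlt_div_r in H2; lra.
Qed.

(** Isometric paths cover both the horizontal and the vertical sides of a rectangle. *)
Lemma Cderivable_continuous_path (h : C -> C) (p : R -> C) (t : R) :
  (forall u v, Cmod (p u - p v) = Rabs (u - v)) -> Cderivable h (p t) ->
  @continuous R_UniformSpace C_UniformSpace (fun u => h (p u)) t.
Proof.
intros Hp Hh; apply continuous_C_eps; intros eps.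
destruct (Cderivable_continuous _ _ Hh eps) as [d Hd].
exists d; intros u Hu; apply Hd; rewrite Hp; exact Hu.
Qed.

Lemma CRInt_minus_const (g : R -> C) (c : C) (a w : R) :
  Cex_RInt g a (a + w) ->
  CRInt (fun t => g t - c)%C a (a + w) = (CRInt g a (a + w) - RtoC w * c)%C.
Proof.
intros Hg.
etransitivity;
  [exact (@RInt_minus C_R_CompleteNormedModule g (fun _ => c) a (a + w) Hg
            (@ex_RInt_const C_R_NormedModule a (a + w) c))|].
rewrite RInt_const, scal_R_Cmult; replace (a + w - a) with w by ring.
reflexivity.
Qed.

Lemma Cmod_CRInt_le_const (g : R -> C) (a w M : R) :
  0 <= w -> Cex_RInt g a (a + w) ->
  (forall t, a <= t <= a + w -> Cmod (g t) <= M) ->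
  Cmod (CRInt g a (a + w)) <= w * M.
Proof.
intros Hw Hg HM.
rewrite Cmod_norm; replace w with (a + w - a) at 2 by ring.
apply (@norm_RInt_le_const C_R_NormedModule g); [lra| |].
- intros t Ht; rewrite <- Cmod_norm; apply HM, Ht.
- apply (@RInt_correct C_R_CompleteNormedModule), Hg.
Qed.

(** * Goursat's theorem on rectangles *)

Section Bisection.

Variable J : R -> R -> R -> R -> R.
Hypothesis J_quarter : forall a b w k,
  J a b w k <= J a b (w / 2) (k / 2) + J (a + w / 2) b (w / 2) (k / 2)
               + J a (b + k / 2) (w / 2) (k / 2) + J (a + w / 2) (b + k / 2) (w / 2) (k / 2).

(* A quarter of the rectangle on which [J] is at least a fourth of its value. *)
Definition quarter_corner (w k : R) (p : R * R) : R * R :=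
  let (a, b) := p in
  let good a' b' := Rle_dec (J a b w k / 4) (J a' b' (w / 2) (k / 2)) in
  if good a b then (a, b)
  else if good (a + w / 2) b then (a + w / 2, b)
  else if good a (b + k / 2) then (a, b + k / 2)
  else (a + w / 2, b + k / 2).

(** Only the corners of the nested rectangles are stored; the [n]-th one has sides [w / 2 ^ n] and
    [k / 2 ^ n]. *)
Fixpoint bisection (a b w k : R) (n : nat) : R * R :=
  match n with
  | O => (a, b)
  | S m => quarter_corner (w / 2 ^ m) (k / 2 ^ m) (bisection a b w k m)
  end.

Lemma quarter_cornerP (w k : R) (p : R * R) :
  let q := quarter_corner w k p in
  J (fst p) (snd p) w k / 4 <= J (fst q) (snd q) (w / 2) (k / 2) /\
  (fst q = fst p \/ fst q = fst p + w / 2) /\ (snd q = snd p \/ snd q = snd p + k / 2).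
Proof.
destruct p as [a b]; unfold quarter_corner; simpl.
pose proof (J_quarter a b w k).
repeat (destruct Rle_dec; [simpl; auto|]).
(* Once three quarters fail the test, [J_quarter] forces the fourth to pass it. *)
simpl; split; [lra|auto].
Qed.

(** Nested intervals: left ends increase and right ends decrease, so the supremum of the left ends
    lies in all of them. *)
Lemma bisection_limit (u : nat -> R) (w : R) :
  0 <= w ->
  (forall n, u (S n) = u n \/ u (S n) = u n + w / 2 ^ n / 2) ->
  exists x, forall n, u n <= x <= u n + w / 2 ^ n.
Proof.
intros Hw Hu.
assert (P : forall n, 0 <= w / 2 ^ n).
{ intros n; apply Rdiv_le_0_compat; [exact Hw|apply pow_lt; lra]. }
assert (S1 : forall n m, u n <= u (n + m)%nat).
{ intros n m; induction m as [|m IH]; [rewrite Nat.add_0_r; lra|].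
  rewrite Nat.add_succ_r; specialize (Hu (n + m)%nat); specialize (P (n + m)%nat); lra. }
assert (S2 : forall n m, u (n + m)%nat + w / 2 ^ (n + m) <= u n + w / 2 ^ n).
{ intros n m; induction m as [|m IH]; [rewrite Nat.add_0_r; lra|].
  rewrite Nat.add_succ_r; specialize (Hu (n + m)%nat); specialize (P (n + m)%nat).
  replace (w / 2 ^ S (n + m)) with (w / 2 ^ (n + m) / 2).
  - lra.
  - simpl; field; apply pow_nonzero; lra. }
destruct (completeness (fun y => exists n, y = u n)) as [x [Hx1 Hx2]].
- exists (u O + w / 2 ^ 0); intros y [n ->].
  specialize (S2 O n); specialize (P n); change (0 + n)%nat with n in S2; lra.
- exists (u O), O; reflexivity.
- exists x; intros n; split; [apply Hx1; exists n; reflexivity|].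
  apply Hx2; intros y [m ->].
  destruct (Nat.le_ge_cases n m) as [H|H].
  + replace m with (n + (m - n))%nat by lia.
    specialize (S2 n (m - n)%nat); specialize (P (n + (m - n))%nat); lra.
  + specialize (S1 m (n - m)%nat); replace (m + (n - m))%nat with n in S1 by lia.
    specialize (P n); lra.
Qed.

End Bisection.

Section Goursat.

Variable h : C -> C.
Hypothesis Hh : forall z : C, Cderivable h z.

Lemma continuous_horizontal (y t : R) :
  @continuous R_UniformSpace C_UniformSpace (fun u => h (u, y)) t.
Proof.
apply (Cderivable_continuous_path h (fun u => (u, y))); [|apply Hh].
intros u v; replace ((u, y) - (v, y))%C with (RtoC (u - v)).
- apply Cmod_R.
- unfold RtoC, Cminus, Cplus, Copp; simpl; f_equal; ring.
Qed.

Lemma continuous_vertical (x t : R) :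
  @continuous R_UniformSpace C_UniformSpace (fun u => h (x, u)) t.
Proof.
apply (Cderivable_continuous_path h (fun u => (x, u))); [|apply Hh].
intros u v; replace ((x, u) - (x, v))%C with (Ci * RtoC (u - v))%C.
- rewrite Cmod_mult, Cmod_R, Cmod_Ci; apply Rmult_1_l.
- unfold Ci, RtoC, Cminus, Cplus, Copp, Cmult; simpl; f_equal; ring.
Qed.

(** The counterclockwise contour integral, with opposite sides paired in one integrand: bottom minus
    top, then right minus left. *)
Definition rect_integral (a b w k : R) : C :=
  (CRInt (fun t => h (t, b) - h (t, (b + k)%R)) a (a + w)
   + Ci * CRInt (fun t => h ((a + w)%R, t) - h (a, t)) b (b + k))%C.

Lemma ex_RInt_horizontal (y y' a b : R) :
  Cex_RInt (fun t => h (t, y) - h (t, y'))%C a b.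
Proof.
apply (@ex_RInt_continuous C_R_CompleteNormedModule); intros t _.
apply (@continuous_minus _ _ C_R_NormedModule (fun t => h (t, y)) (fun t => h (t, y')));
  apply continuous_horizontal.
Qed.

Lemma ex_RInt_vertical (x x' a b : R) :
  Cex_RInt (fun t => h (x, t) - h (x', t))%C a b.
Proof.
apply (@ex_RInt_continuous C_R_CompleteNormedModule); intros t _.
apply (@continuous_minus _ _ C_R_NormedModule (fun t => h (x, t)) (fun t => h (x', t)));
  apply continuous_vertical.
Qed.

(** Inserting the intermediate height [y2] telescopes the difference; this is the cancellation of
    interior edges in a subdivision. *)
Lemma RInt_split_horizontal (y1 y2 y3 a b c : R) :
  CRInt (fun t => h (t, y1) - h (t, y3))%C a c =
  (CRInt (fun t => h (t, y1) - h (t, y2)) a b + CRInt (fun t => h (t, y2) - h (t, y3)) a b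
   + (CRInt (fun t => h (t, y1) - h (t, y2)) b c + CRInt (fun t => h (t, y2) - h (t, y3)) b c))%C.
Proof.
rewrite <- (@RInt_Chasles C_R_CompleteNormedModule _ a b c) by apply ex_RInt_horizontal.
change plus with Cplus; f_equal;
rewrite <- (@RInt_plus C_R_CompleteNormedModule) by apply ex_RInt_horizontal;
apply RInt_ext; intros t _; toC; ring.
Qed.

Lemma RInt_split_vertical (y1 y2 y3 a b c : R) :
  CRInt (fun t => h (y1, t) - h (y3, t))%C a c =
  (CRInt (fun t => h (y1, t) - h (y2, t)) a b + CRInt (fun t => h (y2, t) - h (y3, t)) a b
   + (CRInt (fun t => h (y1, t) - h (y2, t)) b c + CRInt (fun t => h (y2, t) - h (y3, t)) b c))%C.
Proof.
rewrite <- (@RInt_Chasles C_R_CompleteNormedModule _ a b c) by apply ex_RInt_vertical.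
change plus with Cplus; f_equal;
rewrite <- (@RInt_plus C_R_CompleteNormedModule) by apply ex_RInt_vertical;
apply RInt_ext; intros t _; toC; ring.
Qed.

Lemma rect_integral_quarter (a b w k : R) :
  rect_integral a b w k =
  (rect_integral a b (w / 2) (k / 2) + rect_integral (a + w / 2) b (w / 2) (k / 2)
   + (rect_integral a (b + k / 2) (w / 2) (k / 2)
      + rect_integral (a + w / 2) (b + k / 2) (w / 2) (k / 2)))%C.
Proof.
unfold rect_integral.
replace (a + w / 2 + w / 2) with (a + w) by field.
replace (b + k / 2 + k / 2) with (b + k) by field.
rewrite (RInt_split_horizontal b (b + k / 2) (b + k) a (a + w / 2) (a + w)).
rewrite (RInt_split_vertical (a + w) (a + w / 2) a b (b + k / 2) (b + k)).
ring.
Qed.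

(** An affine function integrates to zero around a rectangle, so [h] may be replaced by its
    first-order remainder at [(x, y)], which is at most [eps * (w + k)] on a contour of length
    [2 * (w + k)]. *)
Lemma rect_integral_le (a b w k x y eps : R) (l : C) :
  0 <= w -> 0 <= k -> a <= x <= a + w -> b <= y <= b + k ->
  (forall u v, a <= u <= a + w -> b <= v <= b + k ->
     Cmod (h (u, v) - h (x, y) - ((u, v) - (x, y)) * l) <= eps * (w + k)) ->
  Cmod (rect_integral a b w k) <= 2 * eps * (w + k) ^ 2.
Proof.
intros Hw Hk Hx Hy He.
(* The subtracted constants are the differences of [z * l] across opposite sides; their two
   contributions, each of modulus [w * k * Cmod l], cancel. *)
assert (E : rect_integral a b w k =
  (CRInt (fun t => (h (t, b) - h (t, (b + k)%R)) - RtoC k * (- Ci * l)) a (a + w)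
   + Ci * CRInt (fun t => (h ((a + w)%R, t) - h (a, t)) - RtoC w * l) b (b + k))%C).
{ rewrite (CRInt_minus_const (fun t => h (t, b) - h (t, (b + k)%R))%C) by apply ex_RInt_horizontal.
  rewrite (CRInt_minus_const (fun t => h ((a + w)%R, t) - h (a, t))%C) by apply ex_RInt_vertical.
  unfold rect_integral; ring. }
set (g := fun z => (h z - h (x, y) - (z - (x, y)) * l)%C).
assert (B1 : Cmod (CRInt (fun t => (h (t, b) - h (t, (b + k)%R)) - RtoC k * (- Ci * l))%C a (a + w))
   <= w * (2 * eps * (w + k))).
{ apply Cmod_CRInt_le_const; [assumption| |].
  { apply (@ex_RInt_minus C_R_NormedModule (fun t => h (t, b) - h (t, (b + k)%R))%C).
    - apply ex_RInt_horizontal.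
    - apply ex_RInt_const. }
  intros t Ht.
  replace (h (t, b) - h (t, (b + k)%R) - RtoC k * (- Ci * l))%C
    with (g (t, b) + - g (t, (b + k)%R))%C.
  2:{ unfold g; destruct l as [l1 l2], (h (t, b)), (h (t, b + k)), (h (x, y)).
      unfold Ci, RtoC, Cminus, Cplus, Copp, Cmult; simpl; f_equal; ring. }
  apply Rle_trans with (1 := Cmod_triangle _ _); rewrite Cmod_opp.
  assert (H1 := He t b ltac:(lra) ltac:(lra)).
  assert (H2 := He t (b + k) ltac:(lra) ltac:(lra)).
  unfold g; lra. }
assert (B2 : Cmod (CRInt (fun t => (h ((a + w)%R, t) - h (a, t)) - RtoC w * l)%C b (b + k))
   <= k * (2 * eps * (w + k))).
{ apply Cmod_CRInt_le_const; [assumption| |].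
  { apply (@ex_RInt_minus C_R_NormedModule (fun t => h ((a + w)%R, t) - h (a, t))%C).
    - apply ex_RInt_vertical.
    - apply ex_RInt_const. }
  intros t Ht.
  replace (h ((a + w)%R, t) - h (a, t) - RtoC w * l)%C
    with (g ((a + w)%R, t) + - g (a, t))%C.
  2:{ unfold g; destruct l as [l1 l2], (h (a + w, t)), (h (a, t)), (h (x, y)).
      unfold Ci, RtoC, Cminus, Cplus, Copp, Cmult; simpl; f_equal; ring. }
  apply Rle_trans with (1 := Cmod_triangle _ _); rewrite Cmod_opp.
  assert (H1 := He (a + w) t ltac:(lra) ltac:(lra)).
  assert (H2 := He a t ltac:(lra) ltac:(lra)).
  unfold g; lra. }
rewrite E.
apply Rle_trans with (1 := Cmod_triangle _ _).
rewrite Cmod_mult, Cmod_Ci, Rmult_1_l.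
nra.
Qed.

(** Goursat's argument: bisection keeps the integral at least [c / 4 ^ n], while differentiability
    at the common point of the rectangles bounds it by an arbitrarily small multiple of
    [/ 4 ^ n]. *)
Lemma rect_integral_eq0 (a b w k : R) :
  0 <= w -> 0 <= k -> rect_integral a b w k = RtoC 0.
Proof.
intros Hw Hk.
set (J := fun a b w k => Cmod (rect_integral a b w k)).
set (p := bisection J a b w k).
assert (Hstep : forall n, let q := p (S n) in
  Cmod (rect_integral (fst (p n)) (snd (p n)) (w / 2 ^ n) (k / 2 ^ n)) / 4
    <= Cmod (rect_integral (fst q) (snd q) (w / 2 ^ n / 2) (k / 2 ^ n / 2)) /\
  (fst q = fst (p n) \/ fst q = fst (p n) + w / 2 ^ n / 2) /\
  (snd q = snd (p n) \/ snd q = snd (p n) + k / 2 ^ n / 2)).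
{ intros n; apply (quarter_cornerP J); intros a' b' w' k'; unfold J.
  rewrite (rect_integral_quarter a' b' w' k') at 1.
  rewrite Rplus_assoc.
  eapply Rle_trans; [apply Cmod_triangle|]; apply Rplus_le_compat; apply Cmod_triangle. }
destruct (bisection_limit (fun n => fst (p n)) w Hw) as [x Hx]; [apply Hstep|].
destruct (bisection_limit (fun n => snd (p n)) k Hk) as [y Hy]; [apply Hstep|].
set (c := Cmod (rect_integral a b w k)).
assert (Hc : forall n, c / 4 ^ n
  <= Cmod (rect_integral (fst (p n)) (snd (p n)) (w / 2 ^ n) (k / 2 ^ n))).
{ induction n as [|n IH].
  - simpl; unfold c, Rdiv; rewrite Rinv_1, !Rmult_1_r; apply Rle_refl.
  - destruct (Hstep n) as [H _].
    assert (2 ^ n <> 0) by (apply pow_nonzero; lra).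
    assert (4 ^ n <> 0) by (apply pow_nonzero; lra).
    replace (w / 2 ^ S n) with (w / 2 ^ n / 2) by (simpl; field; auto).
    replace (k / 2 ^ S n) with (k / 2 ^ n / 2) by (simpl; field; auto).
    replace (c / 4 ^ S n) with (c / 4 ^ n / 4) by (simpl; field; auto).
    lra. }
assert (Hsmall : forall eps, 0 < eps -> c <= 2 * eps * (w + k) ^ 2).
{ intros eps Heps.
  destruct (Hh (x, y)) as [l Hl].
  destruct (proj1 (Cis_derive_eps _ _ _) Hl (mkposreal eps Heps)) as [d Hd]; simpl in Hd.
  (* The sum of the two sides bounds the distance from [(x, y)], so the [n]-th rectangle fits in the
     disc where the expansion holds. *)
  assert (Hn : exists n, (w + k) / 2 ^ n < d).
  { destruct (pow_lt_1_zero (/ 2)) with (y := d / (w + k + 1)) as [n Hn].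
    - rewrite Rabs_pos_eq; lra.
    - apply Rdiv_lt_0_compat; [apply d|lra].
    - exists n; specialize (Hn n (Nat.le_refl n)).
      rewrite Rabs_pos_eq in Hn by (apply pow_le; lra).
      assert (0 < (/ 2) ^ n) by (apply pow_lt; lra).
      apply Rlt_div_r in Hn; [|lra].
      unfold Rdiv; rewrite <- pow_inv; nra. }
  destruct Hn as [n Hn].
  assert (P2 : 0 < 2 ^ n) by (apply pow_lt; lra).
  assert (Hw' : 0 <= w / 2 ^ n) by (apply Rdiv_le_0_compat; lra).
  assert (Hk' : 0 <= k / 2 ^ n) by (apply Rdiv_le_0_compat; lra).
  assert (E : w / 2 ^ n + k / 2 ^ n = (w + k) / 2 ^ n) by (field; lra).
  specialize (Hc n); specialize (Hx n); specialize (Hy n); simpl in Hx, Hy.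
  assert (L : Cmod (rect_integral (fst (p n)) (snd (p n)) (w / 2 ^ n) (k / 2 ^ n))
     <= 2 * eps * (w / 2 ^ n + k / 2 ^ n) ^ 2).
  { apply (rect_integral_le _ _ _ _ x y eps l); auto.
    intros u v Hu Hv.
    assert (Huv : Cmod ((u, v) - (x, y)) <= w / 2 ^ n + k / 2 ^ n).
    { apply Rle_trans with (1 := Cmod_le_Rabs _ _); cbn [fst snd Copp].
      apply Rplus_le_compat; apply Rabs_le; lra. }
    apply Rle_trans with (eps * Cmod ((u, v) - (x, y))).
    - apply Hd; lra.
    - apply Rmult_le_compat_l; lra. }
  apply (Rmult_le_reg_r (/ 4 ^ n)); [apply Rinv_0_lt_compat, pow_lt; lra|].
  apply Rle_trans with (1 := Hc).
  apply Rle_trans with (1 := L).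
  apply Req_le; rewrite E.
  replace (4 ^ n) with (2 ^ n * 2 ^ n) by (rewrite <- Rpow_mult_distr; f_equal; lra).
  field; lra. }
apply Cmod_eq_0; fold c.
apply Rle_antisym; [|apply Cmod_ge_0].
apply le_epsilon; intros e He; rewrite Rplus_0_l.
(* The summand 1 keeps the divisor positive when the rectangle is a point. *)
set (W := 2 * (w + k) ^ 2 + 1).
assert (HW : 0 < W) by (unfold W; nra).
specialize (Hsmall (e / W) (Rdiv_lt_0_compat _ _ He HW)).
apply Rle_trans with (1 := Hsmall).
apply Rle_trans with (e / W * W).
- assert (0 < e / W) by (apply Rdiv_lt_0_compat; auto).
  unfold W at 3; nra.
- apply Req_le; field; lra.
Qed.

End Goursat.
(** * The complex exponential *)

Definition Cexp (z : C) : C := (exp (fst z) * cos (snd z), exp (fst z) * sin (snd z)).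

Lemma Cexp_plus (z w : C) : Cexp (z + w) = (Cexp z * Cexp w)%C.
Proof.
destruct z, w; unfold Cexp, Cplus, Cmult; simpl.
rewrite exp_plus, cos_plus, sin_plus; f_equal; ring.
Qed.

Lemma Cexp_0 : Cexp 0 = RtoC 1.
Proof. unfold Cexp, RtoC; simpl; rewrite exp_0, cos_0, sin_0; f_equal; ring. Qed.

Lemma Cexp_opp (z : C) : Cexp (- z) = (/ Cexp z)%C.
Proof.
assert (H : (Cexp z * Cexp (- z))%C = RtoC 1).
{ rewrite <- Cexp_plus, Cplus_opp_r; apply Cexp_0. }
assert (Hz : Cexp z <> RtoC 0).
{ intros E; rewrite E, Cmult_0_l in H; apply (RtoC_inj 0 1) in H; lra. }
rewrite <- (Cmult_1_l (Cexp (- z))), <- (Cinv_l _ Hz), <- Cmult_assoc, H; ring.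
Qed.

Lemma Cexp_period (x : R) : Cexp (x, 2 * PI) = Cexp (x, 0).
Proof. unfold Cexp; simpl; rewrite cos_2PI, sin_2PI, cos_0, sin_0; reflexivity. Qed.

Lemma Cexp_ln (rho theta : R) :
  0 < rho -> Cexp (ln rho, theta) = (RtoC rho * Cis theta)%C.
Proof.
intros H; unfold Cexp, Cis, RtoC, Cmult; simpl; rewrite exp_ln by exact H.
f_equal; ring.
Qed.

Lemma derivable_pt_lim_le (g : R -> R) (x l eps : R) :
  derivable_pt_lim g x l -> 0 < eps -> exists delta : posreal,
  forall t, Rabs t < delta -> Rabs (g (x + t) - g x - l * t) <= eps * Rabs t.
Proof.
intros Hg Heps; destruct (Hg eps Heps) as [d Hd]; exists d; intros t Ht.
destruct (Req_dec t 0) as [->|Ht0].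
- rewrite Rplus_0_r, Rabs_R0; replace (g x - g x - l * 0) with 0 by ring.
  rewrite Rabs_R0; lra.
- specialize (Hd t Ht0 Ht).
  replace (g (x + t) - g x - l * t) with (((g (x + t) - g x) / t - l) * t) by (field; auto).
  rewrite Rabs_mult; apply Rmult_le_compat_r; [apply Rabs_pos|lra].
Qed.

(** The addition formula moves the question to 0, where the real derivatives of [exp], [cos] and
    [sin] suffice. *)
Lemma Cis_derive_Cexp (z : C) : Cis_derive Cexp z (Cexp z).
Proof.
apply Cis_derive_eps; intros eps.
(* With [m] the modulus of the increment, [m <= e <= 1] gives [exp x <= 3]; the five error terms are
   then bounded by 1, 3, 3, 1 and 1 times [e * m], whence the 9. *)
set (e := Rmin 1 (eps / (9 * (1 + Cmod (Cexp z))))).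
assert (Hk : 0 < 1 + Cmod (Cexp z)) by (pose proof (Cmod_ge_0 (Cexp z)); lra).
assert (He : 0 < e).
{ apply Rmin_case; [lra|apply Rdiv_lt_0_compat; [apply eps|lra]]. }
assert (He1 : e <= 1) by apply Rmin_l.
assert (He2 : 9 * e * (1 + Cmod (Cexp z)) <= eps).
{ assert (H : e <= eps / (9 * (1 + Cmod (Cexp z)))) by apply Rmin_r.
  apply Rle_div_r in H; lra. }
destruct (derivable_pt_lim_le exp 0 1 e derivable_pt_lim_exp_0 He) as [d1 H1].
destruct (derivable_pt_lim_le cos 0 0 e derivable_pt_lim_cos_0 He) as [d2 H2].
destruct (derivable_pt_lim_le sin 0 1 e derivable_pt_lim_sin_0 He) as [d3 H3].
assert (Hd : 0 < Rmin e (Rmin d1 (Rmin d2 d3))).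
{ apply Rmin_glb_lt; [exact He|]; repeat apply Rmin_glb_lt; apply cond_pos. }
exists (mkposreal _ Hd); simpl; intros w Hw.
replace w with (z + (w - z))%C at 1 by ring.
rewrite Cexp_plus.
generalize dependent (w - z)%C; intros [x y] Hw.
replace (Cexp z * Cexp (x, y) - Cexp z - (x, y) * Cexp z)%C
  with (Cexp z * (Cexp (x, y) - 1 - (x, y)))%C by ring.
rewrite Cmod_mult.
set (m := Cmod (x, y)) in *.
assert (Hx : Rabs x <= m) by (apply Rle_trans with (2 := Rmax_Cmod (x, y)), Rmax_l).
assert (Hy : Rabs y <= m) by (apply Rle_trans with (2 := Rmax_Cmod (x, y)), Rmax_r).
pose proof (Rmin_l e (Rmin d1 (Rmin d2 d3))); pose proof (Rmin_r e (Rmin d1 (Rmin d2 d3))).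
pose proof (Rmin_l d1 (Rmin d2 d3)); pose proof (Rmin_r d1 (Rmin d2 d3)).
pose proof (Rmin_l d2 d3); pose proof (Rmin_r d2 d3).
specialize (H1 x ltac:(lra)); specialize (H2 y ltac:(lra)); specialize (H3 y ltac:(lra)).
rewrite Rplus_0_l in H1, H2, H3; rewrite exp_0 in H1; rewrite cos_0 in H2; rewrite sin_0 in H3.
assert (E3 : exp x <= 3).
{ apply Rle_trans with (2 := exp_le_3); apply Rle_trans with (exp m);
  [|apply Rlt_le, exp_increasing; lra].
  destruct (Rle_lt_or_eq_dec x m) as [L|L].
  - pose proof (Rle_abs x); lra.
  - apply Rlt_le, exp_increasing, L.
  - rewrite L; apply Rle_refl. }
pose proof (exp_pos x).
assert (B : Cmod (Cexp (x, y) - 1 - (x, y)) <= 9 * e * m).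
{ replace (Cexp (x, y) - 1 - (x, y))%C with
   ((exp x - 1 - 1 * x) + exp x * (cos y - 1 - 0 * y),
    exp x * (sin y - 0 - 1 * y) + ((exp x - 1 - 1 * x) * y + x * y)).
  2:{ unfold Cexp, RtoC, Cminus, Cplus, Copp; simpl; f_equal; ring. }
  apply Rle_trans with (1 := Cmod_le_Rabs _ _).
  pose proof (Rabs_triang (exp x - 1 - 1 * x) (exp x * (cos y - 1 - 0 * y))) as T1.
  pose proof (Rabs_triang (exp x * (sin y - 0 - 1 * y)) ((exp x - 1 - 1 * x) * y + x * y)) as T2.
  pose proof (Rabs_triang ((exp x - 1 - 1 * x) * y) (x * y)) as T3.
  rewrite !Rabs_mult in T1; rewrite !Rabs_mult in T2; rewrite !Rabs_mult in T3.
  rewrite (Rabs_pos_eq (exp x)) in T1, T2 by lra.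
  pose proof (Rabs_pos x); pose proof (Rabs_pos y).
  pose proof (Rabs_pos (exp x - 1 - 1 * x)).
  pose proof (Rabs_pos (cos y - 1 - 0 * y)); pose proof (Rabs_pos (sin y - 0 - 1 * y)).
  assert (Rabs (exp x - 1 - 1 * x) <= e * m) by nra.
  assert (Rabs (cos y - 1 - 0 * y) <= e * m) by nra.
  assert (Rabs (sin y - 0 - 1 * y) <= e * m) by nra.
  assert (Rabs (exp x - 1 - 1 * x) * Rabs y <= e * m * 1) by (apply Rmult_le_compat; lra).
  assert (exp x * Rabs (cos y - 1 - 0 * y) <= 3 * (e * m)) by (apply Rmult_le_compat; lra).
  assert (exp x * Rabs (sin y - 0 - 1 * y) <= 3 * (e * m)) by (apply Rmult_le_compat; lra).
  assert (Rabs x * Rabs y <= e * m) by (apply Rmult_le_compat; lra).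
  lra. }
assert (0 <= m) by apply Cmod_ge_0.
pose proof (Cmod_ge_0 (Cexp z)).
apply Rle_trans with (Cmod (Cexp z) * (9 * e * m)).
- apply Rmult_le_compat_l; lra.
- apply Rle_trans with (9 * e * (1 + Cmod (Cexp z)) * m).
  + assert (0 <= e * m) by nra; nra.
  + apply Rmult_le_compat_r; lra.
Qed.

(* The two normed module structures on C have different balls, but the same derivatives. *)
Lemma Cis_derive_AbsRing (h : C -> C) (z l : C) :
  Cis_derive h z l <-> @is_derive C_AbsRing (AbsRing_NormedModule C_AbsRing) h z l.
Proof.
split; intros [_ H]; (split; [apply is_linear_scal_l|exact H]).
Qed.

Lemma Cis_derive_comp (h g : C -> C) (z l m : C) :
  Cis_derive h (g z) l -> Cis_derive g z m -> Cis_derive (fun w => h (g w)) z (m * l)%C.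
Proof.
intros Hh Hg; apply Cis_derive_AbsRing in Hg.
exact (is_derive_comp h g z l m Hh Hg).
Qed.

Lemma Cis_derive_mult (h g : C -> C) (z l m : C) :
  Cis_derive h z l -> Cis_derive g z m ->
  Cis_derive (fun w => h w * g w)%C z (l * g z + h z * m)%C.
Proof.
rewrite !Cis_derive_AbsRing; intros Hh Hg.
exact (is_derive_mult h g z l m Hh Hg Cmult_comm).
Qed.

Lemma Cis_derive_linear (c z : C) : Cis_derive (fun w => c * w)%C z c.
Proof.
apply Cis_derive_eps; intros eps; exists (mkposreal 1 Rlt_0_1); intros w _.
replace (c * w - c * z - (w - z) * c)%C with (RtoC 0) by ring.
rewrite Cmod_0; apply Rmult_le_pos; [apply Rlt_le, cond_pos|apply Cmod_ge_0].
Qed.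

(** * Coefficient integrals over ellipses *)

(* The coefficient integrand in the coordinate [z = ln rho + i theta], up to the
   factor [rho ^ n]. *)
Definition log_pullback (f : C -> C) (n : nat) (z : C) : C :=
  (f (/ 2 * (Cexp z + Cexp (-(1) * z))) * Cexp (- INR n * z))%C.

Lemma Cderivable_log_pullback (f : C -> C) (n : nat) (z : C) :
  entire f -> Cderivable (log_pullback f n) z.
Proof.
intros Hf; destruct (Hf (/ 2 * (Cexp z + Cexp (-(1) * z)))%C) as [l Hl].
eexists; unfold log_pullback.
apply Cis_derive_mult.
- apply (Cis_derive_comp f (fun w => / 2 * (Cexp w + Cexp (-(1) * w)))%C); [exact Hl|].
  apply (Cis_derive_comp (fun w => / 2 * w)%C (fun w => Cexp w + Cexp (-(1) * w))%C);
    [apply Cis_derive_linear|].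
  apply (@is_derive_plus C_AbsRing C_NormedModule Cexp (fun w => Cexp (-(1) * w)%C));
    [apply Cis_derive_Cexp|].
  apply (Cis_derive_comp Cexp (fun w => -(1) * w)%C); [apply Cis_derive_Cexp|].
  apply Cis_derive_linear.
- apply (Cis_derive_comp Cexp (fun w => - INR n * w)%C); [apply Cis_derive_Cexp|].
  apply Cis_derive_linear.
Qed.

(** With [w = rho * Cis theta], the power [w ^ (-n)] in the pullback carries a factor [rho ^ (-n)],
    which [rho ^ n] compensates. *)
Lemma log_pullback_ellipse (f : C -> C) (n : nat) (rho theta : R) :
  0 < rho ->
  (f (ellipse rho theta) * Cis (- (INR n * theta)))%C =
  (RtoC (rho ^ n) * log_pullback f n (ln rho, theta))%C.
Proof.
intros Hr; unfold log_pullback, ellipse, joukowski.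
rewrite <- Cexp_ln, <- Cexp_opp by exact Hr.
replace (/ 2 * (Cexp (ln rho, theta) + Cexp (-(1) * (ln rho, theta))))%C
  with ((Cexp (ln rho, theta) + Cexp (- (ln rho, theta))) / 2)%C.
2:{ replace (-(1) * (ln rho, theta))%C with (- (ln rho, theta))%C by ring.
    unfold Cdiv; ring. }
replace (Cis (- (INR n * theta)))
  with (RtoC (rho ^ n) * Cexp (- INR n * (ln rho, theta)))%C.
- ring.
- rewrite <- (exp_ln (rho ^ n)) by (apply pow_lt, Hr).
  rewrite ln_pow by exact Hr.
  unfold Cexp, Cis, RtoC, Copp, Cmult; simpl.
  replace (- INR n * ln rho - - 0 * theta) with (- (INR n * ln rho)) by ring.
  replace (- INR n * theta + - 0 * ln rho) with (- (INR n * theta)) by ring.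
  pose proof (exp_pos (INR n * ln rho)).
  rewrite exp_Ropp; f_equal; field; lra.
Qed.

Lemma log_pullback_period (f : C -> C) (n : nat) (x : R) :
  log_pullback f n (x, 2 * PI) = log_pullback f n (x, 0).
Proof.
unfold log_pullback.
(* Used twice: [m = n] for the power factor and [m = 1] for the term [/ w] of the Joukowski map. *)
assert (E : forall m : nat, Cexp (- INR m * (x, (2 * PI)%R))%C = Cexp (- INR m * (x, 0%R))%C).
{ intros m; unfold Cexp, RtoC, Copp, Cmult; simpl.
  replace (- INR m * x - - 0 * (2 * PI)) with (- INR m * x - - 0 * 0) by ring.
  replace (- INR m * (2 * PI) + - 0 * x) with (- (0 + 2 * INR m * PI)) by ring.
  replace (- INR m * 0 + - 0 * x) with 0 by ring.
  rewrite cos_neg, sin_neg, cos_period, sin_period, cos_0, sin_0.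
  f_equal; ring. }
rewrite (E n); specialize (E 1%nat); change (INR 1) with 1 in E; rewrite E, Cexp_period.
reflexivity.
Qed.

(* Cauchy's theorem in the logarithmic coordinate: the horizontal sides of
   the rectangle cancel by periodicity. *)
Lemma RInt_log_pullback (f : C -> C) (n : nat) (s : R) :
  entire f -> 0 <= s ->
  CRInt (fun t => log_pullback f n (s, t)) 0 (2 * PI) =
  CRInt (fun t => log_pullback f n (0, t)) 0 (2 * PI).
Proof.
intros Hf Hs; pose proof PI_RGT_0.
set (h := log_pullback f n).
assert (Hh : forall z, Cderivable h z) by (intros z; apply Cderivable_log_pullback, Hf).
pose proof (rect_integral_eq0 h Hh 0 0 s (2 * PI) Hs ltac:(lra)) as E.
unfold rect_integral in E.
rewrite !Rplus_0_l in E.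
assert (E1 : CRInt (fun t => h (t, 0%R) - h (t, (2 * PI)%R))%C 0 s = RtoC 0).
{ transitivity (CRInt (fun _ => RtoC 0) 0 s).
  - apply RInt_ext; intros t _; unfold h; rewrite log_pullback_period; toC; ring.
  - rewrite RInt_const, scal_R_Cmult; toC; ring. }
rewrite E1, Cplus_0_l in E.
assert (Hv : forall x, Cex_RInt (fun t => h (x, t)) 0 (2 * PI)).
{ intros x; apply (@ex_RInt_continuous C_R_CompleteNormedModule); intros t _.
  apply continuous_vertical, Hh. }
assert (E2 : (CRInt (fun t => h (s, t)) 0 (2 * PI) - CRInt (fun t => h (0%R, t)) 0 (2 * PI))%C
             = RtoC 0).
{ transitivity (CRInt (fun t => h (s, t) - h (0%R, t))%C 0 (2 * PI)).
  - symmetry; exact (@RInt_minus C_R_CompleteNormedModule _ _ _ _ (Hv s) (Hv 0)).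
  - destruct (CRInt (fun t => h (s, t) - h (0%R, t))%C 0 (2 * PI)) as [p q].
    unfold Ci, Cmult, RtoC in E; simpl in E; injection E; intros; unfold RtoC; f_equal; lra. }
assert (Hsub : forall p q : C, (p - q)%C = RtoC 0 -> p = q).
{ intros p q H0; replace p with (p - q + q)%C by ring; rewrite H0; ring. }
apply Hsub, E2.
Qed.

(** Its modulus is the denominator of [kappa_Ch1]; it equals [2 * PI * rho ^ n] times the [n]-th
    Laurent coefficient of [f] composed with [joukowski]. *)
Definition laurent_integral (f : C -> C) (n : nat) (rho : R) : C :=
  CRInt (fun theta => f (ellipse rho theta) * Cis (- (INR n * theta)))%C 0 (2 * PI).

Lemma ex_RInt_laurent (f : C -> C) (n : nat) (rho a b : R) :
  entire f -> 0 < rho ->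
  Cex_RInt (fun theta => f (ellipse rho theta) * Cis (- (INR n * theta)))%C a b.
Proof.
intros Hf Hr.
apply (@ex_RInt_ext C_R_NormedModule
  (fun t => scal (rho ^ n) (log_pullback f n (ln rho, t)))).
- intros t _; rewrite log_pullback_ellipse, scal_R_Cmult by exact Hr; reflexivity.
- apply (@ex_RInt_scal C_R_NormedModule).
  apply (@ex_RInt_continuous C_R_CompleteNormedModule); intros t _.
  apply continuous_vertical; intros z; apply Cderivable_log_pullback, Hf.
Qed.

Lemma laurent_integral_pow (f : C -> C) (n : nat) (rho : R) :
  entire f -> 1 <= rho ->
  laurent_integral f n rho = (RtoC (rho ^ n) * laurent_integral f n 1)%C.
Proof.
intros Hf Hr.
assert (E : forall r, 1 <= r -> laurent_integral f n r =
  (RtoC (r ^ n) * CRInt (fun t => log_pullback f n (0%R, t)) 0 (2 * PI))%C).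
{ intros r Hr1; rewrite <- (RInt_log_pullback f n (ln r) Hf).
  2:{ rewrite <- ln_1; apply ln_le; lra. }
  rewrite <- scal_R_Cmult, <- (@RInt_scal C_R_CompleteNormedModule).
  - unfold laurent_integral.
    apply (@RInt_ext C_R_CompleteNormedModule); intros t _; rewrite log_pullback_ellipse, scal_R_Cmult by lra; reflexivity.
  - apply (@ex_RInt_continuous C_R_CompleteNormedModule); intros t _.
    apply continuous_vertical; intros z; apply Cderivable_log_pullback, Hf. }
rewrite (E rho Hr), (E 1) by apply Rle_refl.
rewrite pow1; ring.
Qed.
(** * Chebyshev coefficients as integrals over the circle *)

Lemma ellipse_1 (theta : R) : ellipse 1 theta = RtoC (cos theta).
Proof.
pose proof (sin2_cos2 theta) as H; unfold Rsqr in H.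
unfold ellipse, joukowski; rewrite Cmult_1_l.
unfold Cis, Cdiv, RtoC, Cinv, Cplus, Cmult; simpl.
replace (cos theta * (cos theta * 1) + sin theta * (sin theta * 1)) with 1 by lra.
f_equal; field.
Qed.

Definition cos_integrand (f : C -> C) (n : nat) (theta : R) : C :=
  (RtoC (cos (INR n * theta)) * f (RtoC (cos theta)))%C.

Lemma continuous_cos_integrand (f : C -> C) (n : nat) (t : R) :
  entire f -> @continuous R_UniformSpace C_UniformSpace (cos_integrand f n) t.
Proof.
intros Hf.
apply (@continuous_ext R_UniformSpace C_UniformSpace
  (fun u => @scal R_AbsRing C_R_NormedModule (cos (INR n * u)) (f (RtoC (cos u))))).
{ intros u; apply scal_R_Cmult. }
apply (@continuous_scal R_UniformSpace R_AbsRing C_R_NormedModule).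
- apply (ex_derive_continuous (fun u => cos (INR n * u))); auto_derive; exact I.
- apply (continuous_comp cos (fun x => f (RtoC x))).
  + apply (ex_derive_continuous cos); auto_derive; exact I.
  + apply (continuous_horizontal f Hf).
Qed.

Lemma ex_RInt_cos_integrand (f : C -> C) (n : nat) (a b : R) :
  entire f -> Cex_RInt (cos_integrand f n) a b.
Proof.
intros Hf; apply (@ex_RInt_continuous C_R_CompleteNormedModule); intros t _.
apply continuous_cos_integrand, Hf.
Qed.

(** The reflection [t -> 2 * c - t] carries the second half of the interval onto the first; its
    Jacobian -1 is absorbed by swapping the bounds. *)
Lemma RInt_fold (g : R -> C) (c : R) :
  (forall a b, Cex_RInt g a b) ->
  CRInt g 0 (2 * c) = CRInt (fun t => g t + g (2 * c - t)%R)%C 0 c.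
Proof.
intros Hg.
assert (Hopp : forall t, opp (scal (-1) (g (-1 * t + 2 * c))) = g (2 * c - t)).
{ intros t; replace (-1 * t + 2 * c) with (2 * c - t) by ring.
  assert (E : forall z : C, (- (RtoC (-1) * z))%C = z).
  { intros [x y]; unfold RtoC, Copp, Cmult; simpl; f_equal; ring. }
  rewrite scal_R_Cmult; apply E. }
assert (Hlin : forall a b, Cex_RInt (fun t => scal (-1) (g (-1 * t + 2 * c))) a b).
{ intros a b; apply (@ex_RInt_comp_lin C_R_NormedModule), Hg. }
assert (Hr : Cex_RInt (fun t => g (2 * c - t)) 0 c).
{ apply (@ex_RInt_ext C_R_NormedModule (fun t => opp (scal (-1) (g (-1 * t + 2 * c))))).
  - intros t _; apply Hopp.
  - apply (@ex_RInt_opp C_R_NormedModule), Hlin. }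
assert (E : CRInt g c (2 * c) = CRInt (fun t => g (2 * c - t)) 0 c).
{ replace c with (-1 * c + 2 * c) at 1 by ring.
  replace (2 * c) with (-1 * 0 + 2 * c) at 2 by ring.
  rewrite <- (@RInt_comp_lin C_R_CompleteNormedModule) by apply Hg.
  rewrite <- (@opp_RInt_swap C_R_CompleteNormedModule) by apply Hlin.
  rewrite <- (@RInt_opp C_R_CompleteNormedModule) by apply Hlin.
  apply (@RInt_ext C_R_CompleteNormedModule); intros t _; apply Hopp. }
rewrite <- (@RInt_Chasles C_R_CompleteNormedModule g 0 c (2 * c)) by apply Hg.
rewrite E; symmetry; exact (@RInt_plus C_R_CompleteNormedModule _ _ 0 c (Hg 0 c) Hr).
Qed.

(** Under [t -> 2 * PI - t] the value of [f] is unchanged and the exponential is conjugated, so the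
    sines cancel and the cosines double. *)
Lemma laurent_integral_1 (f : C -> C) (n : nat) :
  entire f -> laurent_integral f n 1 = (RtoC 2 * CRInt (cos_integrand f n) 0 PI)%C.
Proof.
intros Hf; unfold laurent_integral.
rewrite RInt_fold by (intros a b; apply ex_RInt_laurent; [exact Hf|lra]).
rewrite <- scal_R_Cmult, <- (@RInt_scal C_R_CompleteNormedModule)
  by apply ex_RInt_cos_integrand, Hf.
apply (@RInt_ext C_R_CompleteNormedModule); intros t _.
rewrite !ellipse_1, scal_R_Cmult; unfold cos_integrand.
replace (cos (2 * PI - t)) with (cos t).
2:{ replace (2 * PI - t) with (- t + 2 * INR 1 * PI) by (simpl; ring).
    rewrite cos_period, cos_neg; reflexivity. }
replace (Cis (- (INR n * (2 * PI - t)))) with (Cis (INR n * t)).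
2:{ replace (- (INR n * (2 * PI - t))) with (- (- (INR n * t) + 2 * INR n * PI)) by ring.
    unfold Cis; rewrite cos_neg, sin_neg, cos_period, sin_period, cos_neg, sin_neg.
    f_equal; ring. }
unfold Cis; rewrite cos_neg, sin_neg.
destruct (f (RtoC (cos t))).
unfold RtoC, Cplus, Cmult; simpl; f_equal; ring.
Qed.

Lemma acos_at_left : filterlim acos (at_left 1) (locally 0).
Proof.
apply filterlim_locally; intros eps.
(* The cap 1, below [PI / 2], makes [cos d] nonnegative, so points between [cos d] and 1 lie where
   [cos_acos] applies. *)
set (d := Rmin eps 1).
assert (Hd : 0 < d) by (apply Rmin_glb_lt; [apply cond_pos|lra]).
assert (Hd1 : d <= 1) by apply Rmin_r.
assert (Hde : d <= eps) by apply Rmin_l.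
pose proof PI2_1.
assert (Hc : cos d < 1) by (rewrite <- cos_0; apply cos_decreasing_1; lra).
assert (Hc' : 0 < 1 - cos d) by lra.
exists (mkposreal _ Hc'); intros x Hx Hx1.
apply Rabs_def2 in Hx; unfold minus, plus, opp in Hx; simpl in Hx.
assert (0 <= cos d) by (apply cos_ge_0; lra).
destruct (acos_bound x) as [B1 B2].
assert (acos x < d).
{ destruct (Rlt_le_dec (acos x) d) as [L|L]; [exact L|].
  assert (E : cos (acos x) <= cos d) by (apply cos_decr_1; lra).
  rewrite cos_acos in E; lra. }
apply Rabs_def1; unfold minus, plus, opp; simpl; lra.
Qed.

(** Reflected from the other endpoint by [acos (- x) = PI - acos x]. *)
Lemma acos_at_right : filterlim acos (at_right (-1)) (locally PI).
Proof.
apply filterlim_locally; intros eps.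
destruct (proj1 (filterlim_locally acos 0) acos_at_left eps) as [d Hd].
exists d; intros x Hx Hx1.
apply Rabs_def2 in Hx; unfold minus, plus, opp in Hx; simpl in Hx.
specialize (Hd (- x)).
assert (H : ball 0 eps (acos (- x))).
{ apply Hd; [|lra]; apply Rabs_def1; unfold minus, plus, opp; simpl; lra. }
apply Rabs_def2 in H; rewrite acos_opp in H; unfold minus, plus, opp in H; simpl in H.
apply Rabs_def1; unfold minus, plus, opp; simpl; lra.
Qed.

(** Substitution [theta = acos x], whose derivative is minus the Chebyshev weight; the sign reverses
    the bounds. *)
Lemma is_RInt_cheb (f : C -> C) (n : nat) (a b : R) :
  entire f -> -1 < a < 1 -> -1 < b < 1 ->
  @is_RInt C_R_NormedModule
    (fun x => f (RtoC x) * RtoC (ChebT n x) / RtoC (sqrt (1 - x ^ 2)))%C a b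
    (CRInt (cos_integrand f n) (acos b) (acos a)).
Proof.
intros Hf Ha Hb.
assert (Hin : forall x, Rmin a b <= x <= Rmax a b -> -1 < x < 1).
{ intros x Hx; revert Hx; unfold Rmin, Rmax; destruct Rle_dec; lra. }
assert (H := @is_RInt_comp C_R_CompleteNormedModule (cos_integrand f n) acos
          (fun x => -1 / sqrt (1 - x ^ 2)) a b
          (fun x _ => continuous_cos_integrand f n _ Hf)).
assert (Hp : forall x, -1 < x < 1 -> 0 < 1 - x ^ 2) by (intros x Hx; nra).
assert (Hs : forall x, -1 < x < 1 -> 0 < sqrt (1 - x ^ 2))
  by (intros x Hx; apply sqrt_lt_R0, Hp, Hx).
rewrite <- (@opp_RInt_swap C_R_CompleteNormedModule) by apply ex_RInt_cos_integrand, Hf.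
eapply (@is_RInt_ext C_R_NormedModule); [|apply (@is_RInt_opp C_R_NormedModule), H].
- intros x Hx; cbv beta.
  assert (Hx1 : -1 < x < 1) by (apply Hin; lra).
  specialize (Hs x Hx1).
  unfold cos_integrand, ChebT; rewrite cos_acos, scal_R_Cmult by lra.
  change opp with Copp.
  replace (RtoC (-1 / sqrt (1 - x ^ 2))) with (- / RtoC (sqrt (1 - x ^ 2)))%C.
  + toC; unfold Cdiv; ring.
  + rewrite <- RtoC_inv, <- RtoC_opp by lra; f_equal; field; lra.
- intros x Hx; specialize (Hin x Hx); split.
  + apply is_derive_Reals.
    rewrite <- Rsqr_pow2, <- (derive_pt_acos x Hin).
    apply derive_pt_eq_1 with (derivable_pt_acos x Hin); reflexivity.
  + apply (ex_derive_continuous (fun x => -1 / sqrt (1 - x ^ 2))).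
    specialize (Hp x Hin); specialize (Hs x Hin).
    auto_derive; change (1 + - (x * (x * 1))) with (1 - x ^ 2); repeat split; lra.
Qed.

(** In the variable [theta] the improper integral becomes a proper one with bounds tending to 0 and
    [PI], and an integral is continuous in its bounds. *)
Lemma cheb_coef_laurent (f : C -> C) (n : nat) :
  entire f -> cheb_coef f n = (RtoC (1 / PI) * laurent_integral f n 1)%C.
Proof.
intros Hf; rewrite laurent_integral_1 by exact Hf.
unfold cheb_coef; rewrite (is_RInt_gen_unique _ (CRInt (cos_integrand f n) 0 PI)).
- rewrite Cmult_assoc, <- RtoC_mult; do 2 f_equal; field; apply PI_neq0.
- set (g := fun ab : R * R => CRInt (cos_integrand f n) (acos (snd ab)) (acos (fst ab))).
  assert (L : filterlim g (filter_prod (at_right (-1)) (at_left 1))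
     (@locally C_UniformSpace (CRInt (cos_integrand f n) 0 PI))).
  { apply (filterlim_comp_2 (G := locally 0) (H := locally PI)
      (fun ab : R * R => acos (snd ab)) (fun ab : R * R => acos (fst ab))
      (fun u v => CRInt (cos_integrand f n) u v)).
    - exact (filterlim_comp _ _ _ _ _ _ _ _ filterlim_snd acos_at_left).
    - exact (filterlim_comp _ _ _ _ _ _ _ _ filterlim_fst acos_at_right).
    - intros P HP.
      apply (@continuous_RInt C_R_NormedModule (cos_integrand f n) 0 PI
        (fun u v => CRInt (cos_integrand f n) u v)) in HP.
      + destruct HP as [e He].
        apply Filter_prod with (ball 0 e) (ball PI e);
          [apply locally_ball|apply locally_ball|].
        intros u v Hu Hv; apply (He (u, v)); split; assumption.
      + apply filter_forall; intros z.
        apply (@RInt_correct C_R_CompleteNormedModule), ex_RInt_cos_integrand, Hf. }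
  intros P HP; specialize (L P HP); unfold filtermap in L.
  (* Near the endpoints both bounds are eventually interior, where the substitution is valid. *)
  assert (Hd : filter_prod (at_right (-1)) (at_left 1)
    (fun ab : R * R => -1 < fst ab < 1 /\ -1 < snd ab < 1)).
  { apply Filter_prod with (fun a => -1 < a < 1) (fun b => -1 < b < 1).
    - exists (mkposreal 1 Rlt_0_1); intros x Hx Hx1.
      apply Rabs_def2 in Hx; unfold minus, plus, opp in Hx; simpl in Hx; lra.
    - exists (mkposreal 1 Rlt_0_1); intros x Hx Hx1.
      apply Rabs_def2 in Hx; unfold minus, plus, opp in Hx; simpl in Hx; lra.
    - intros x y Hx Hy; split; assumption. }
  unfold filtermapi; generalize (filter_and _ _ L Hd); apply filter_imp.
  intros [a b] [H1 [H2 H3]]; simpl in H2, H3.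
  exists (g (a, b)); split; [apply is_RInt_cheb; auto|exact H1].
Qed.

(** * The condition number in terms of the mean modulus *)

Lemma ex_RInt_Cmod_ellipse (f : C -> C) (rho : R) :
  entire f -> 0 < rho -> ex_RInt (fun theta => Cmod (f (ellipse rho theta))) 0 (2 * PI).
Proof.
intros Hf Hr.
(* At index 0 the power factor is 1, so the pullback is [f] on the ellipse. *)
apply ex_RInt_ext with (fun t => @norm _ C_R_NormedModule (log_pullback f 0 (ln rho, t))).
- intros t _; rewrite <- Cmod_norm.
  pose proof (log_pullback_ellipse f 0 rho t Hr) as E.
  simpl in E; rewrite Rmult_0_l, Ropp_0, Cmult_1_l in E; rewrite <- E.
  unfold Cis; rewrite cos_0, sin_0, Cmod_mult.
  replace (Cmod (1, 0)) with (Cmod (RtoC 1)) by reflexivity.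
  rewrite Cmod_1, Rmult_1_r; reflexivity.
- apply (@ex_RInt_continuous R_CompleteNormedModule); intros t _.
  apply (continuous_comp (fun t => log_pullback f 0 (ln rho, t)) (@norm _ C_R_NormedModule)).
  + apply continuous_vertical; intros z; apply Cderivable_log_pullback, Hf.
  + apply (@filterlim_norm _ C_R_NormedModule).
Qed.

Lemma Cmod_laurent_le_abs_mean (f : C -> C) (n : nat) (rho : R) :
  entire f -> 0 < rho -> Cmod (laurent_integral f n rho) <= PI * abs_mean f rho.
Proof.
intros Hf Hr; unfold abs_mean.
pose proof PI_RGT_0.
rewrite <- Rmult_assoc; replace (PI * (1 / PI)) with 1 by (field; lra); rewrite Rmult_1_l.
rewrite Cmod_norm.
apply (@norm_RInt_le C_R_NormedModule
  (fun theta => f (ellipse rho theta) * Cis (- (INR n * theta)))%C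
  (fun theta => Cmod (f (ellipse rho theta))) 0 (2 * PI)).
- lra.
- intros t _; rewrite <- Cmod_norm, Cmod_mult.
  apply Req_le; replace (Cmod (Cis (- (INR n * t)))) with 1; [ring|].
  unfold Cmod, Cis; simpl; rewrite !Rmult_1_r, Rplus_comm.
  change (1 = sqrt (Rsqr (sin (- (INR n * t))) + Rsqr (cos (- (INR n * t))))).
  rewrite sin2_cos2, sqrt_1; reflexivity.
- apply (@RInt_correct C_R_CompleteNormedModule), ex_RInt_laurent; assumption.
- apply (@RInt_correct R_CompleteNormedModule), ex_RInt_Cmod_ellipse; assumption.
Qed.

Lemma Cmod_laurent_pos (f : C -> C) (n : nat) :
  entire f -> cheb_coef f n <> RtoC 0 -> 0 < Cmod (laurent_integral f n 1).
Proof.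
intros Hf Hn; apply Cmod_gt_0; intros E; apply Hn.
rewrite cheb_coef_laurent, E by exact Hf; ring.
Qed.

(** The coefficient integral at radius [rho] is [rho ^ n >= 1] times the one at radius 1. A single
    index with nonzero coefficient thus bounds the mean away from 0 uniformly in [rho]. *)
Lemma abs_mean_lower_bound (f : C -> C) (n : nat) (rho : R) :
  entire f -> 1 <= rho -> Cmod (laurent_integral f n 1) / PI <= abs_mean f rho.
Proof.
intros Hf Hr; pose proof PI_RGT_0.
pose proof (Cmod_laurent_le_abs_mean f n rho Hf ltac:(lra)) as L.
rewrite laurent_integral_pow, Cmod_mult, Cmod_R in L by assumption.
pose proof (pow_R1_Rle rho n Hr) as Hp.
rewrite Rabs_pos_eq in L by lra.
pose proof (Cmod_ge_0 (laurent_integral f n 1)).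
apply Rle_div_l; [assumption|].
rewrite Rmult_comm; apply Rle_trans with (2 := L).
rewrite <- (Rmult_1_l (Cmod _)) at 1; apply Rmult_le_compat_r; assumption.
Qed.

(** Isolates the dependence on [rho]: the first factor depends on [n] only. *)
Lemma kappa_Ch1_eq (f : C -> C) (n : nat) (rho : R) :
  entire f -> 1 <= rho ->
  kappa_Ch1 f n rho =
  PI / Cmod (laurent_integral f n 1) * (abs_mean f rho / rho ^ n).
Proof.
intros Hf Hr; unfold kappa_Ch1, abs_mean.
fold (laurent_integral f n rho).
rewrite laurent_integral_pow, Cmod_mult, Cmod_R by assumption.
assert (0 < rho ^ n) by (apply pow_lt; lra).
rewrite Rabs_pos_eq by lra.
pose proof PI_RGT_0.
set (I := RInt _ _ _); set (d := Cmod _).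
replace (PI / d * (1 / PI * I / rho ^ n)) with (I * (/ rho ^ n * / d)).
- unfold Rdiv; rewrite Rinv_mult; reflexivity.
- unfold Rdiv; rewrite Rmult_1_l, <- !Rmult_assoc, (Rmult_comm _ (/ PI)), <- !Rmult_assoc.
  rewrite Rinv_l by lra; ring.
Qed.

Lemma is_optimal_radius_abs_mean (f : C -> C) (n : nat) (rho r : R) :
  entire f -> cheb_coef f n <> RtoC 0 -> is_optimal_radius f n rho -> 1 <= r ->
  abs_mean f rho / rho ^ n <= abs_mean f r / r ^ n.
Proof.
intros Hf Hn [Hrho Hopt] Hr.
specialize (Hopt r Hr); rewrite !kappa_Ch1_eq in Hopt by assumption.
apply Rmult_le_reg_l with (2 := Hopt).
apply Rdiv_lt_0_compat; [apply PI_RGT_0|apply Cmod_laurent_pos; assumption].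
Qed.

(** * Asymptotics of the minimizer *)

(** The function [exp v - 1 - v] is convex with minimum at 0; the bound follows from the tangents of
    [exp] at [delta] and [- delta]. *)
Lemma exp_sub_ge (delta v : R) :
  0 < delta -> delta <= Rabs v ->
  Rmin (exp delta - 1 - delta) (exp (- delta) - 1 + delta) <= exp v - 1 - v.
Proof.
intros Hd Hv.
pose proof (exp_ineq1_le (v - delta)) as H1.
pose proof (exp_ineq1_le (v + delta)) as H2.
destruct (Rle_lt_dec 0 v) as [Hv0|Hv0].
- rewrite Rabs_pos_eq in Hv by exact Hv0.
  apply Rle_trans with (1 := Rmin_l _ _).
  replace v with (delta + (v - delta)) at 1 by ring; rewrite exp_plus.
  pose proof (exp_ineq1_le delta); nra.
- rewrite Rabs_left in Hv by exact Hv0.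
  apply Rle_trans with (1 := Rmin_r _ _).
  replace v with (- delta + (v + delta)) at 1 by ring; rewrite exp_plus.
  assert (exp (- delta) < 1) by (rewrite <- exp_0; apply exp_increasing; lra).
  pose proof (exp_pos (- delta)); nra.
Qed.

Section Asymptotics.

Variables (M : R -> R) (mu nu sigma c : R) (P : nat -> Prop) (rho : nat -> R).
Hypotheses (Hmu : 0 < mu) (Hnu : 0 < nu) (Hc : 0 < c).
Hypothesis HM : is_lim (fun x => M x / (exp (mu * Rpower x nu) * Rpower x sigma)) p_infty 1.
Hypothesis HMc : forall x, 1 <= x -> c <= M x.
Hypothesis Hrho : forall n, P n -> 1 <= rho n.
Hypothesis Hmin : forall n r, P n -> 1 <= r -> M (rho n) / rho n ^ n <= M r / r ^ n.

Lemma model_bounds : exists X, 1 <= X /\ forall x, X < x ->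
  exp (mu * Rpower x nu) * Rpower x sigma / 2 <= M x
  <= 2 * (exp (mu * Rpower x nu) * Rpower x sigma).
Proof.
apply is_lim_spec in HM.
(* Tolerance 1/2 puts the ratio between 1/2 and 3/2, within a factor 2 of 1. *)
destruct (HM (mkposreal (1 / 2) ltac:(lra))) as [X HX]; simpl in HX.
exists (Rmax X 1); split; [apply Rmax_r|].
intros x Hx.
specialize (HX x (Rle_lt_trans _ _ _ (Rmax_l X 1) Hx)).
assert (E : 0 < exp (mu * Rpower x nu) * Rpower x sigma)
  by (apply Rmult_lt_0_compat; apply exp_pos).
set (e := exp (mu * Rpower x nu) * Rpower x sigma) in *.
apply Rabs_def2 in HX.
replace (M x) with (M x / e * e) by (field; lra).
split; nra.
Qed.

(** If [rho n <= X], comparison with the radius [2 * X] gives [M (rho n) <= M (2 * X) / 2 ^ n],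
    which drops below the lower bound [c] for large [n]. *)
Lemma argmin_eventually_gt (X : R) :
  1 <= X -> eventually (fun n => P n -> X < rho n).
Proof.
intros HX.
destruct (nfloor_ex (Rmax 0 (M (2 * X) / c)) (Rmax_l _ _)) as [N [_ HN]].
exists (S N); intros n Hn Pn.
destruct (Rlt_le_dec X (rho n)) as [L|L]; [exact L|exfalso].
specialize (Hmin n (2 * X) Pn ltac:(lra)); specialize (Hrho n Pn).
assert (0 < M (2 * X)) by (specialize (HMc (2 * X)); lra).
specialize (HMc (rho n) Hrho).
assert (Hp : 0 < rho n ^ n) by (apply pow_lt; lra).
assert (0 < X ^ n) by (apply pow_lt; lra).
assert (rho n ^ n <= X ^ n) by (apply pow_incr; lra).
(* Bernoulli's inequality turns the linear threshold [N] into an exponential one. *)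
assert (H2n : INR n <= 2 ^ n).
{ replace 2 with (1 + 1) by ring; pose proof (poly n 1 Rlt_0_1); lra. }
assert (INR (S N) <= INR n) by (apply le_INR, Hn).
rewrite S_INR in *.
assert (HN' : M (2 * X) / c < 2 ^ n).
{ apply Rle_lt_trans with (1 := Rmax_r 0 _); lra. }
apply Rlt_div_l in HN'; [|exact Hc].
apply (proj1 (Rle_div_l _ _ _ Hp)) in Hmin.
rewrite Rpow_mult_distr in Hmin.
assert (0 < 2 ^ n) by (apply pow_lt; lra).
assert (M (2 * X) / (2 ^ n * X ^ n) * rho n ^ n <= M (2 * X) / 2 ^ n).
{ replace (M (2 * X) / 2 ^ n) with (M (2 * X) / (2 ^ n * X ^ n) * X ^ n) by (field; lra).
  apply Rmult_le_compat_l; [|assumption].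
  apply Rlt_le, Rdiv_lt_0_compat; [assumption|apply Rmult_lt_0_compat; assumption]. }
assert (M (2 * X) / 2 ^ n < c) by (apply Rlt_div_l; lra).
lra.
Qed.

(** The minimizer of [exp (mu * x ^ nu) * x ^ (sigma - n)], that is, the root of
    [mu * nu * x ^ nu = n - sigma]; meaningful once [n > sigma]. *)
Definition predicted_radius (n : nat) : R := Rpower ((INR n - sigma) / (mu * nu)) (/ nu).

Lemma eventually_INR_gt (x : R) : eventually (fun n => x < INR n).
Proof.
destruct (nfloor_ex (Rmax 0 x) (Rmax_l _ _)) as [N [_ HN]].
exists (S N); intros n Hn; apply le_INR in Hn; rewrite S_INR in Hn.
apply Rle_lt_trans with (1 := Rmax_r 0 x); lra.
Qed.

Lemma predicted_radius_eventually_gt (X : R) :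
  0 < X -> eventually (fun n => X < predicted_radius n).
Proof.
intros HX.
apply filter_imp with (2 := eventually_INR_gt (sigma + mu * nu * Rpower X nu)).
intros n Hn; unfold predicted_radius.
assert (Hmn : 0 < mu * nu) by nra.
assert (Hp : 0 < Rpower X nu) by apply exp_pos.
replace X with (Rpower (Rpower X nu) (/ nu)).
- apply Rlt_Rpower_l; [apply Rinv_0_lt_compat, Hnu|split; [exact Hp|]].
  apply Rlt_div_r; lra.
- rewrite Rpower_mult, Rinv_r, Rpower_1 by lra; reflexivity.
Qed.

(* In terms of [v = nu * ln (rho n / predicted_radius n)], the logarithm of the
   model function [exp (mu * x ^ nu) * x ^ (sigma - n)] exceeds its minimum by
   [(n - sigma) / nu * (exp v - 1 - v)]. *)
Lemma argmin_excess : eventually (fun n => P n ->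
  let v := nu * (ln (rho n) - ln (predicted_radius n)) in
  exp v - 1 - v <= 2 * nu * ln 2 / (INR n - sigma)).
Proof.
destruct model_bounds as [X [HX HB]].
generalize (filter_and (F := eventually) _ _ (argmin_eventually_gt X HX)
  (filter_and (F := eventually) _ _ (predicted_radius_eventually_gt X ltac:(lra)) (eventually_INR_gt sigma))).
apply filter_imp; intros n [H1 [H2 H3]] Pn.
specialize (H1 Pn).
specialize (Hmin n (predicted_radius n) Pn ltac:(lra)).
pose proof (proj1 (HB _ H1)) as B1; pose proof (proj2 (HB _ H2)) as B2.
assert (Hmn : 0 < mu * nu) by nra.
(* Stationarity of the model at the predicted radius. *)
assert (Hr : mu * exp (nu * ln (predicted_radius n)) = (INR n - sigma) / nu).
{ unfold predicted_radius, Rpower; rewrite ln_exp, <- Rmult_assoc, Rinv_r, Rmult_1_l by lra.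
  rewrite exp_ln by (apply Rdiv_lt_0_compat; lra); field; lra. }
set (r := predicted_radius n) in *.
set (a := ln (rho n)); set (b := ln r) in *.
assert (Ea : forall x, 0 < x -> x ^ n = exp (INR n * ln x)).
{ intros x Hx; rewrite <- Rpower_pow by exact Hx; reflexivity. }
(* Minimality in logarithmic form: replacing [M] by the model costs one [ln 2] at each of the two
   radii. *)
assert (Hln : mu * exp (nu * a) + sigma * a - INR n * a - ln 2
              <= mu * exp (nu * b) + sigma * b - INR n * b + ln 2).
{ apply Rnot_lt_le; intros L; apply exp_increasing in L.
  apply (Rlt_not_le _ _ L).
  unfold Rminus in *; rewrite !exp_plus, !exp_Ropp, !exp_ln by lra.
  rewrite !Ea in Hmin by lra; fold a b in Hmin.
  unfold Rpower in B1, B2; fold a in B1; fold b in B2.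
  pose proof (exp_pos (INR n * a)); pose proof (exp_pos (INR n * b)).
  apply Rle_trans with (M (rho n) / exp (INR n * a)).
  - replace (exp (mu * exp (nu * a)) * exp (sigma * a) * / exp (INR n * a) * / 2)
      with (exp (mu * exp (nu * a)) * exp (sigma * a) / 2 / exp (INR n * a)) by (field; lra).
    apply Rmult_le_compat_r; [apply Rlt_le, Rinv_0_lt_compat; lra|exact B1].
  - apply Rle_trans with (1 := Hmin).
    replace (exp (mu * exp (nu * b)) * exp (sigma * b) * / exp (INR n * b) * 2)
      with (2 * (exp (mu * exp (nu * b)) * exp (sigma * b)) / exp (INR n * b)) by (field; lra).
    apply Rmult_le_compat_r; [apply Rlt_le, Rinv_0_lt_compat; lra|exact B2]. }
cbv zeta; set (v := nu * (a - b)).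
replace (nu * a) with (nu * b + v) in Hln by (unfold v; ring).
rewrite exp_plus, <- Rmult_assoc, Hr in Hln.
apply Rle_div_r; [lra|].
apply Rmult_le_reg_r with (/ nu); [apply Rinv_0_lt_compat, Hnu|].
replace (2 * nu * ln 2 * / nu) with (2 * ln 2) by (field; lra).
replace ((exp v - 1 - v) * (INR n - sigma) * / nu)
  with ((INR n - sigma) / nu * exp v - (INR n - sigma) / nu - (INR n - sigma) * (a - b))
  by (unfold v; field; lra).
lra.
Qed.

(** The excess bound tends to 0, which forces [v] to 0, and the ratio of radii is [exp (v / nu)]. *)
Lemma argmin_asymptotics :
  filterlim (fun n => rho n / predicted_radius n) (within P eventually) (locally 1).
Proof.
apply filterlim_locally; intros eps.
assert (Hcont : continuous (fun v => exp (v / nu)) 0)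
  by (apply (ex_derive_continuous (fun v => exp (v / nu))); auto_derive; exact I).
unfold continuous in Hcont.
replace (exp (0 / nu)) with 1 in Hcont
  by (unfold Rdiv; rewrite Rmult_0_l, exp_0; reflexivity).
destruct (proj1 (filterlim_locally _ 1) Hcont eps) as [d Hd].
(* A positive lower bound for the excess when [Rabs v >= d]; solving
   [2 * nu * ln 2 / (n - sigma) < eta] for [n] gives the threshold below. *)
set (eta := Rmin (exp d - 1 - d) (exp (- d) - 1 + d)).
pose proof (cond_pos d) as Hd0.
assert (Heta : 0 < eta).
{ pose proof (exp_ineq1 d ltac:(lra)); pose proof (exp_ineq1 (- d) ltac:(lra)).
  apply Rmin_glb_lt; lra. }
unfold within.
generalize (filter_and (F := eventually) _ _ argmin_excess
  (filter_and (F := eventually) _ _ (eventually_INR_gt (sigma + 2 * nu * ln 2 / eta)) (eventually_INR_gt sigma))).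
apply filter_imp; intros n [H1 [H2 H3]] Pn.
specialize (H1 Pn); specialize (Hrho n Pn); cbv zeta in H1.
assert (Hr : 0 < predicted_radius n) by apply exp_pos.
replace (rho n / predicted_radius n)
  with (exp (nu * (ln (rho n) - ln (predicted_radius n)) / nu)).
2:{ replace (nu * (ln (rho n) - ln (predicted_radius n)) / nu)
      with (ln (rho n) + - ln (predicted_radius n)) by (field; lra).
    rewrite exp_plus, exp_Ropp, !exp_ln by lra; reflexivity. }
set (v := nu * (ln (rho n) - ln (predicted_radius n))) in *.
apply Hd.
assert (Hv : Rabs v < d).
{ destruct (Rlt_le_dec (Rabs v) d) as [L|L]; [exact L|exfalso].
  pose proof (exp_sub_ge d v Hd0 L) as H4; fold eta in H4.
  assert (H5 : 2 * nu * ln 2 / eta < INR n - sigma) by lra.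
  apply Rlt_div_l in H5; [|exact Heta].
  assert (H6 : 2 * nu * ln 2 / (INR n - sigma) < eta) by (apply Rlt_div_l; lra).
  lra. }
unfold ball; simpl; unfold AbsRing_ball, minus, plus, opp; simpl.
rewrite Ropp_0, Rplus_0_r; exact Hv.
Qed.

End Asymptotics.

Theorem theorem3p6 (f : C -> C) (mu nu sigma : R) (rho_opt : nat -> R)
    (hf : entire_transcendental f)
    (hmu : 0 < mu) (hnu : 0 < nu)
    (hM : is_lim
            (fun rho => abs_mean f rho /
                        (exp (mu * Rpower rho nu) * Rpower rho sigma))
            p_infty 1)
    (hopt : forall n : nat,
        cheb_coef f n <> RtoC 0 -> is_optimal_radius f n (rho_opt n)) :
  filterlim
    (fun n : nat => rho_opt n / Rpower ((INR n - sigma) / (mu * nu)) (/ nu))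
    (within (fun n : nat => cheb_coef f n <> RtoC 0) eventually)
    (locally 1).
Proof.
destruct hf as [Hf _].
(* A nonzero coefficient supplies the lower bound [c]; if there is none, the limit along the empty
   set of indices holds vacuously. *)
destruct (classic (exists m, cheb_coef f m <> RtoC 0)) as [[m Hm]|Hnone].
- apply (argmin_asymptotics (abs_mean f) mu nu sigma (Cmod (laurent_integral f m 1) / PI));
    try assumption.
  + apply Rdiv_lt_0_compat; [apply Cmod_laurent_pos; assumption|apply PI_RGT_0].
  + intros x Hx; apply abs_mean_lower_bound; assumption.
  + intros n Hn; apply hopt, Hn.
  + intros n r Hn Hr; apply is_optimal_radius_abs_mean; auto.
- intros Q _; exists O; intros n _ Hn; exfalso; apply Hnone; exists n; exact Hn.
Qed.
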